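(* Let the data, mesh family, offset $\ell_h$ and weights $\omega_{ij}^b$ be as in the context. There exist $h_0>0$ and $\theta\in(0,1)$, independent of $h$, $n$, $i$, $b$, such that for $0<h\le h_0$ and every $n$ the following hold. (i) For fixed values $(V_j)_{j\in\mathcal I_h^\circ}$ at the interior nodes, the map $T_n:\mathbb R^{\mathcal I_h^\partial}\to\mathbb R^{\mathcal I_h^\partial}$, $$(T_nz)_i=\inf_{b\in B}\frac{\sum_{j\in\mathcal I_h^\circ}\omega_{ij}^bV_j+\sum_{j\in\mathcal I_h^\partial}\omega_{ij}^bz_j+\ell_hg(t_n,x_i,b)}{1+\ell_hk(t_n,x_i,b)},\qquad i\in\mathcal I_h^\partial,$$ satisfies $$\|T_nz-T_n\widetilde z\|_\infty\le\sup_{i\in\mathcal I_h^\partial,\,b\in B}\frac{\sum_{j\in\mathcal I_h^\partial}\omega_{ij}^b}{1+\ell_hk(t_n,x_i,b)}\|z-\widetilde z\|_\infty\le(1-\theta)\|z-\widetilde z\|_\infty\qquad\text{for all }z,\widetilde z,$$ hence the boundary values (the solution of $z=T_nz$) are obtained by the contraction iteration $z^{(q+1)}=T_nz^{(q)}$. (ii) In the linear case, i.e. when the boundary data carry no control ($B=\{b\}$ a singleton; write $\omega_{ij}=\omega_{ij}^b$, $k_i=k(t_n,x_i,b)$), the boundary coefficient matrix $M=(M_{ij})_{i,j\in\mathcal I_h^\partial}$ with entries $M_{ii}=1+\ell_hk_i-\omega_{ii}$ and $M_{ij}=-\omega_{ij}$ for $i\ne j$ satisfies $$M_{ii}-\sum_{j\in\mathcal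 I_h^\partial,\,j\ne i}|M_{ij}|=\ell_hk_i+\sum_{j\in\mathcal I_h^\circ}\omega_{ij}\ge\theta\qquad(i\in\mathcal I_h^\partial),$$ and $M$ is a nonsingular $M$-matrix.
   Context: **Domain and data.** $T>0$; $\mathcal O\subset\mathbb R^N$ is a nonempty bounded domain with boundary of class $C^3$; $n(x)$ is the unit outward normal at $x\in\partial\mathcal O$; $B\subset\mathbb R^{N_B}$ is nonempty and compact; $g,k:[0,T]\times\partial\mathcal O\times B\to\mathbb R$ are continuous and $k\ge0$; $\gamma:\partial\mathcal O\times\mathcal V\to\mathbb R^N$, with $\mathcal V\subseteq\mathbb R^{N_B}$ open and $B\subset\mathcal V$, is of class $C^1$, and $|\gamma(x,b)|=1$, $\langle n(x),\gamma(x,b)\rangle>0$ for all $(x,b)\in\partial\mathcal O\times B$. Time levels: $t_n=n\Delta t$, $\Delta t=T/N_T$, $0\le n\le N_T-1$. **Mesh and interpolation.** For each $h$ in a family with $h\to0$, $\mathcal O_h$ is a polyhedral approximation of $\mathcal O$ with a shape-regular simplicial triangulation $\mathbb T_h$, $h=\max_{\mathsf T\in\mathbb T_h}\operatorname{diam}\mathsf T$, whose vertices $\mathcal G_h=\{x_i:i\in\mathcal I_h\}$ lie in $\overline{\mathcal O}$; $\mathcal I_h=\mathcal I_h^\circ\,\dot\cup\,\mathcal I_h^\partial$ with $x_i\in\mathcal O$ for $i\in\mathcal I_h^\circ$, $x_i\in\partial\mathcal O$ for $i\in\mathcal I_h^\partial$. $\widehat{\mathbb T}_h$ is the associated exact triangulation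 of $\overline{\mathcal O}$ with the same vertices and possibly curved boundary elements, and $p_h:\overline{\mathcal O}\to\overline{\mathcal O_h}$ maps each element of $\widehat{\mathbb T}_h$ to the corresponding simplex of $\mathbb T_h$, fixing the vertices. With $\{\psi_j\}$ the continuous piecewise-linear nodal basis on $\mathbb T_h$, $I_h[V](x)=\sum_{j\in\mathcal I_h}\psi_j(p_h(x))V_j$ for $x\in\overline{\mathcal O}$ and a grid vector $V$. The mesh family satisfies $\|I_h[\phi|_{\mathcal G_h}]-\phi\|_{L^\infty(\overline{\mathcal O})}\le C_\phi h^2$ for all $\phi\in C^2(\overline{\mathcal O})$, with $C_\phi$ independent of $h$. **Offset and weights.** Fix constants $0<c_0\le c_1$ and $\ell_h$, independent of $\Delta t$, with $c_0h\le\ell_h\le c_1h$. For $i\in\mathcal I_h^\partial$ and $b\in B$ set $y_{i,b}=x_i-\ell_h\gamma(x_i,b)$, which lies in $\mathcal O$ for all sufficiently small $h$, uniformly in $i,b$, and $\omega_{ij}^b=\psi_j(p_h(y_{i,b}))$ for $j\in\mathcal I_h$. **M-matrix.** A nonsingular $M$-matrix is a nonsingular real square matrix with nonpositive off-diagonal entries whose inverse is entrywise nonnegative. *)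

(* Defs.v *)
From HB Require Import structures.
From mathcomp Require Export all_boot all_order all_algebra.
From mathcomp Require Export all_classical all_reals all_analysis.
Export numFieldNormedType.Exports.

Set Implicit Arguments.
Unset Strict Implicit.
Unset Printing Implicit Defensive.
Import Order.TTheory GRing.Theory Num.Theory.

Local Open Scope classical_set_scope.
Local Open Scope ring_scope.

(* The norm `|_| of 'rV[R]_N is the max norm, so the Euclidean structure of
   R^N is introduced separately; both induce the same topology. *)
Definition dotp (R : realType) (N : nat) (u v : 'rV[R]_N) : R :=
  \sum_i u 0 i * v 0 i.

Definition enorm (R : realType) (N : nat) (u : 'rV[R]_N) : R :=
  Num.sqrt (dotp u u).

Definition ediam (R : realType) (N : nat) (A : set 'rV[R]_N) : R :=
  sup [set enorm (x - y) | x in A & y in A].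

Definition eball (R : realType) (N : nat) (c : 'rV[R]_N) (r : R) :
  set 'rV[R]_N := [set x | enorm (x - c) < r].

Definition bdry (T : topologicalType) (A : set T) : set T :=
  closure A `\` A°.

(* Class C^k on an open set D: on a finite-dimensional U this is the usual
   notion: for a C^1 map, the derivative in any direction v is a linear
   combination of the partial derivatives. *)
Fixpoint Ck (R : realType) (U W : normedModType R) (k : nat) (D : set U)
    (f : U -> W) {struct k} : Prop :=
  (forall x, D x -> {for x, continuous f}) /\
  match k with
  | 0 => True
  | k'.+1 => forall v : U,
      (forall x, D x -> derivable f x v) /\ Ck k' D ('D_v f)
  end.

(* Class C^k on an arbitrary subset S (used for S = bdry O `*` V, where bdry O
   is a hypersurface): local extendability to a C^k map on an open set. *)
Definition Ck_rel (R : realType) (U W : normedModType R) (k : nat)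
    (S : set U) (f : U -> W) : Prop :=
  forall p, S p -> exists D F,
    [/\ open_nbhs p D, Ck k D F & forall q, S q -> D q -> F q = f q].

(* C^k(closure D), D open: f is C^k on D and f and its derivatives of order
   at most k extend continuously to closure D (the extension of 'D_v f is g;
   only the values of f on closure D matter). *)
Fixpoint Ck_closure (R : realType) (U W : normedModType R) (k : nat)
    (D : set U) (f : U -> W) {struct k} : Prop :=
  {within closure D, continuous f} /\
  match k with
  | 0 => True
  | k'.+1 => forall v : U,
      (forall x, D x -> derivable f x v) /\
      exists g : U -> W, (forall x, D x -> g x = 'D_v f x) /\ Ck_closure k' D g
  end.

Definition grad (R : realType) (N : nat) (f : 'rV[R]_N -> R) (x : 'rV[R]_N) :
  'rV[R]_N := \row_i 'D_(delta_mx 0 i) f x.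

(* rho is a local C^k defining function of D at the boundary point x. *)
Definition defining_function (R : realType) (N : nat) (k : nat)
    (D : set 'rV[R]_N) (x : 'rV[R]_N) (U : set 'rV[R]_N)
    (rho : 'rV[R]_N -> R) : Prop :=
  [/\ open_nbhs x U, Ck k U rho,
      (forall y, U y -> (D y <-> rho y < 0)) & grad rho x != 0].

Definition boundary_of_class (R : realType) (N : nat) (k : nat)
    (D : set 'rV[R]_N) : Prop :=
  forall x, bdry D x -> exists U rho, defining_function k D x U rho.

(* Independent of rho: two defining functions at x have gradients that are
   positive multiples of each other. *)
Definition outward_unit_normal (R : realType) (N : nat) (D : set 'rV[R]_N)
    (x v : 'rV[R]_N) : Prop :=
  exists U rho, defining_function 1 D x U rho /\
    v = (enorm (grad rho x))^-1 *: grad rho x.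

(* A triangulation with nint + nbd vertices; the vertices lshift nbd j are the
   interior ones (index set I_h^o) and the vertices rshift nint i those on the
   boundary.  A simplex is given by the set of its vertices; curved s is the
   possibly curved element associated with the simplex s, proj is the map p_h
   and basis j is psi_j.  As proj and basis j are total functions, only their
   values on closure O, resp. on the polyhedron, are constrained below. *)
Record mesh (R : realType) (N : nat) := Mesh {
  nint : nat;
  nbd : nat;
  node : 'I_(nint + nbd) -> 'rV[R]_N;
  simplices : {set {set 'I_(nint + nbd)}};
  curved : {set 'I_(nint + nbd)} -> set 'rV[R]_N;
  proj : 'rV[R]_N -> 'rV[R]_N;
  basis : 'I_(nint + nbd) -> 'rV[R]_N -> R }.

Arguments node {R N} m _.
Arguments curved {R N} m _ _.
Arguments basis {R N} m _ _.

Section Mesh.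
Variables (R : realType) (N : nat).
Implicit Type M : mesh R N.

Definition hull M (s : {set 'I_(nint M + nbd M)}) : set 'rV[R]_N :=
  [set x | exists a : 'I_(nint M + nbd M) -> R,
     [/\ forall i, 0 <= a i, \sum_(i in s) a i = 1 &
         x = \sum_(i in s) a i *: node M i]].

Definition aff_indep M (s : {set 'I_(nint M + nbd M)}) : Prop :=
  forall a : 'I_(nint M + nbd M) -> R,
    \sum_(i in s) a i = 0 -> \sum_(i in s) a i *: node M i = 0 ->
    forall i, i \in s -> a i = 0.

Definition polyhedron M : set 'rV[R]_N :=
  [set x | exists2 s, s \in simplices M & hull s x].

Definition mesh_size M : R :=
  \big[Num.max/0]_(s in simplices M) ediam (hull s).

Definition simplicial_triangulation M : Prop :=
  [/\ injective (node M),
      forall i, exists2 s, s \in simplices M & i \in s,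
      forall s, s \in simplices M -> #|s| = N.+1 /\ aff_indep s &
      forall s s', s \in simplices M -> s' \in simplices M ->
        hull s `&` hull s' = hull (s :&: s')].

Definition exact_triangulation (O : set 'rV[R]_N) M : Prop :=
  [/\ closure O = [set x | exists2 s, s \in simplices M & curved M s x],
      forall s, s \in simplices M ->
        closed (curved M s) /\ (forall i, curved M s (node M i) <-> i \in s),
      forall s s', s \in simplices M -> s' \in simplices M -> s != s' ->
        (curved M s)° `&` (curved M s')° = set0 &
      (* only boundary elements may be curved *)
      forall s, s \in simplices M ->
        (forall i : 'I_(nbd M), rshift (nint M) i \notin s) ->
        curved M s = hull s].

Definition element_map M : Prop :=
  (forall s, s \in simplices M -> forall x, curved M s x -> hull s (proj M x)) /\
  (forall i, proj M (node M i) = node M i).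

Definition nodal_basis M : Prop :=
  forall j : 'I_(nint M + nbd M),
    [/\ {within polyhedron M, continuous (basis M j)},
        forall s, s \in simplices M -> exists (c : 'rV[R]_N) (d : R),
          forall x, hull s x -> basis M j x = dotp c x + d &
        forall i, basis M j (node M i) = (i == j)%:R].

Definition mesh_of (O : set 'rV[R]_N) (h : R) M : Prop :=
  [/\ simplicial_triangulation M /\ mesh_size M = h,
      (forall j : 'I_(nint M), O (node M (lshift (nbd M) j))) /\
      (forall i : 'I_(nbd M), bdry O (node M (rshift (nint M) i))),
      exact_triangulation O M,
      element_map M &
      nodal_basis M].

Definition interpolant M (V : 'I_(nint M + nbd M) -> R) (x : 'rV[R]_N) : R :=
  \sum_j basis M j (proj M x) * V j.

Definition shape_regular (H : set R) (M : R -> mesh R N) : Prop :=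
  exists2 sigma : R, 0 < sigma &
    forall h, H h -> forall s, s \in simplices (M h) ->
      exists c, eball c (sigma * ediam (hull s)) `<=` hull s.

(* The L^oo norm on closure O is the supremum of the pointwise values. *)
Definition interpolation_estimate (O : set 'rV[R]_N) (H : set R)
    (M : R -> mesh R N) : Prop :=
  forall phi : 'rV[R]_N -> R, Ck_closure 2 O phi ->
    exists C : R, forall h, H h -> forall x, closure O x ->
      `|interpolant (fun j => phi (node (M h) j)) x - phi x| <= C * h ^+ 2.

End Mesh.

Definition time_level (R : realType) (T : R) (NT n : nat) : R :=
  n%:R * (T / NT%:R).

Section Scheme.
Variables (R : realType) (N NB : nat) (M : mesh R N) (l t : R).
Variables (gamma : 'rV[R]_N * 'rV[R]_NB -> 'rV[R]_N).
Variables (g k : R -> 'rV[R]_N -> 'rV[R]_NB -> R).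

Definition bnode (i : 'I_(nbd M)) : 'rV[R]_N := node M (rshift (nint M) i).

Definition offset_point (i : 'I_(nbd M)) (b : 'rV[R]_NB) : 'rV[R]_N :=
  bnode i - l *: gamma (bnode i, b).

Definition weight (i : 'I_(nbd M)) (b : 'rV[R]_NB)
    (j : 'I_(nint M + nbd M)) : R :=
  basis M j (proj M (offset_point i b)).

Definition weight_int i b (j : 'I_(nint M)) : R :=
  weight i b (lshift (nbd M) j).

Definition weight_bd i b (j : 'I_(nbd M)) : R :=
  weight i b (rshift (nint M) j).

(* V holds the values at the interior nodes, z those at the boundary nodes. *)
Definition Tn (B : set 'rV[R]_NB) (V : 'rV[R]_(nint M)) (z : 'rV[R]_(nbd M)) :
    'rV[R]_(nbd M) :=
  \row_i inf [set (\sum_j weight_int i b j * V 0 j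
                   + \sum_j weight_bd i b j * z 0 j
                   + l * g t (bnode i) b)
                  / (1 + l * k t (bnode i) b) | b in B].

Definition Tn_lipschitz_const (B : set 'rV[R]_NB) : R :=
  sup [set (\sum_j weight_bd i b j) / (1 + l * k t (bnode i) b)
      | i in [set: 'I_(nbd M)] & b in B].

Definition boundary_matrix (b : 'rV[R]_NB) : 'M[R]_(nbd M) :=
  \matrix_(i, j) (if i == j then 1 + l * k t (bnode i) b - weight_bd i b i
                  else - weight_bd i b j).

End Scheme.

Definition nonsingular_M_matrix (R : realType) (m : nat) (A : 'M[R]_m) : Prop :=
  [/\ A \in unitmx,
      forall i j, i != j -> A i j <= 0 &
      forall i j, 0 <= invmx A i j].

(* Main.v *)
From HB Require Import structures.
From mathcomp Require Import lra ring.
Require Import Defs.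

Set Implicit Arguments.
Unset Strict Implicit.
Unset Printing Implicit Defensive.
Import Order.TTheory GRing.Theory Num.Theory.

Local Open Scope classical_set_scope.
Local Open Scope ring_scope.

(** The point is a uniform positive lower bound theta for the total weight
    carried by the interior nodes at an offset point y = x_i - l gamma(x_i, b).
    The rest is soft: the weights at y are the barycentric coordinates of
    p_h(y), hence nonnegative of sum 1 ([barycentric]), so the boundary weights
    sum to at most 1 - theta, T_n is a contraction ([Tn_lipschitz],
    [contraction_iteration]), and the boundary matrix is strictly diagonally
    dominant with nonpositive off-diagonal entries ([boundary_M_matrix]).

    The lower bound comes from testing the weights against affine functions.
    Near a boundary point x0 with local defining function rho and gradient
    G = grad rho x0, consider v(x) = - <G, x - x_i>, where x_i is near x0.
    By obliqueness v(y) = l <G, gamma> >= c l >= c c0 h.  Applied to the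
    coordinate functions, the interpolation estimate says that
    |p_h(y) - y| <= C h^2, so that sum_j w_j v(x_j) = v(p_h(y)) is still of
    order h.  A node x_j of positive weight lies within K h of x_i.  If it is on
    the boundary, rho vanishes at x_i and x_j, and strict differentiability of
    rho gives |v(x_j)| <= eps K h: the boundary nodes contribute only a small
    multiple of h.  Interior nodes contribute at most |G|_1 K h times their
    total weight, so this weight is bounded below ([interior_weight_bound]).
    As G is the gradient at the fixed point x0, all constants are common to the
    points x_i near x0, and compactness of the boundary makes them uniform
    ([uniform_interior_weight]). *)

(** * Row vectors: maximum norm and Euclidean norm *)

Section RowVectors.
Variables (R : realType) (m : nat).
Implicit Types u v w : 'rV[R]_m.

Lemma coord_le_norm u i : `|u 0 i| <= `|u|.
Proof.
rewrite [leRHS]/Num.Def.normr/= mx_normrE.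
by rewrite (@le_bigmax _ _ _ 0 (fun ij => `|u ij.1 ij.2|) (0, i)).
Qed.

Lemma norm_le_coord u (c : R) :
  0 <= c -> (forall i, `|u 0 i| <= c) -> `|u| <= c.
Proof.
move=> c0 uc; rewrite [leLHS]/Num.Def.normr/= mx_normrE.
by apply: bigmax_le => // -[i j] _ /=; rewrite (ord1 i).
Qed.

Lemma dotpBr u v w : dotp u (v - w) = dotp u v - dotp u w.
Proof.
by rewrite /dotp -sumrB; apply: eq_bigr => i _; rewrite !mxE mulrBr.
Qed.

Lemma dotpZr u a v : dotp u (a *: v) = a * dotp u v.
Proof.
by rewrite /dotp mulr_sumr; apply: eq_bigr => i _; rewrite !mxE mulrCA.
Qed.

Lemma dotpZl u a v : dotp (a *: u) v = a * dotp u v.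
Proof.
by rewrite /dotp mulr_sumr; apply: eq_bigr => i _; rewrite !mxE mulrA.
Qed.

Lemma dotp_sumr (I : finType) (P : pred I) u (F : I -> 'rV[R]_m) :
  dotp u (\sum_(i | P i) F i) = \sum_(i | P i) dotp u (F i).
Proof.
rewrite /dotp exchange_big; apply: eq_bigr => i _.
by rewrite summxE mulr_sumr.
Qed.

Lemma dotp_le u v : `|dotp u v| <= (\sum_i `|u 0 i|) * `|v|.
Proof.
rewrite /dotp mulr_suml (le_trans (ler_norm_sum _ _ _))//.
by apply: ler_sum => i _; rewrite normrM ler_wpM2l// coord_le_norm.
Qed.

Lemma dotp_ge0 u : 0 <= dotp u u.
Proof. by apply: sumr_ge0 => i _; rewrite -expr2 sqr_ge0. Qed.

Lemma norm_le_enorm u : `|u| <= enorm u.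
Proof.
apply: norm_le_coord => [|i]; first exact: sqrtr_ge0.
rewrite -[leLHS]sqrtr_sqr ler_sqrt ?dotp_ge0//.
rewrite /dotp (bigD1 i)//= -expr2 lerDl sumr_ge0// => j _.
by rewrite -expr2 sqr_ge0.
Qed.

Lemma enorm_le_norm u : enorm u <= Num.sqrt m%:R * `|u|.
Proof.
rewrite -[X in _ * X]ger0_norm// -sqrtr_sqr -sqrtrM ?ler0n//.
rewrite ler_wsqrtr// /dotp.
apply: (@le_trans _ _ (\sum_(i < m) `|u| ^+ 2)).
  apply: ler_sum => i _; rewrite -expr2 -[u 0 i ^+ 2]real_normK ?num_real//.
  by rewrite lerXn2r ?nnegrE// coord_le_norm.
by rewrite sumr_const card_ord mulr_natl.
Qed.

Lemma continuous_dotp u : continuous (dotp u : 'rV[R]_m -> R).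
Proof.
apply: continuous_big => [|i _ v]; first exact: add_continuous.
have := @coord_continuous R 1 m 0 i v.
exact: (cvgM (FF := nbhs_filter v) (cvg_cst _)).
Qed.

End RowVectors.

(** * Infima and contractions *)

Section FixedPoint.
Variables (R : realType).

(** If one of the two families is unbounded below then so is the other, as they
    are at bounded distance; both infima are then 0 by convention. *)
Lemma le_dist_inf (T : Type) (B : set T) (f f' : T -> R) (d : R) :
  B !=set0 -> (forall b, B b -> `|f b - f' b| <= d) ->
  `|inf [set f b | b in B] - inf [set f' b | b in B]| <= d.
Proof.
move=> [b0 Bb0] ffd.
have half (p q : T -> R) : (forall b, B b -> `|p b - q b| <= d) ->
    has_lbound [set p b | b in B] ->
    has_lbound [set q b | b in B] /\
    inf [set p b | b in B] - d <= inf [set q b | b in B].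
  move=> pqd hp.
  have lb : lbound [set q b | b in B] (inf [set p b | b in B] - d).
    move=> _ [b Bb <-]; have := pqd _ Bb; rewrite ler_distl => /andP[_ pq].
    rewrite lerBlDr; apply: le_trans pq.
    by apply: ge_inf => //; exists b.
  split; first by exists (inf [set p b | b in B] - d).
  by apply: lb_le_inf => //; exists (q b0), b0.
have d0 : 0 <= d by apply: le_trans (ffd _ Bb0).
have ffd' b : B b -> `|f' b - f b| <= d by move=> /ffd; rewrite distrC.
have [hf|hf] := pselect (has_lbound [set f b | b in B]).
  have [hf' lef] := half _ _ ffd hf.
  have [_ lef'] := half _ _ ffd' hf'.
  by rewrite ler_distl lef' -lerBlDr.
have hf' : ~ has_lbound [set f' b | b in B].
  by move=> h; apply: hf; have [] := half _ _ ffd' h.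
by rewrite !inf_out ?subrr ?normr0// => -[].
Qed.

Lemma contraction_iteration (m : nat) (F : 'rV[R]_m -> 'rV[R]_m) (q : R) :
  0 <= q -> q < 1 -> (forall z z', `|F z - F z'| <= q * `|z - z'|) ->
  exists zs : 'rV[R]_m,
    [/\ zs = F zs, forall z, z = F z -> z = zs &
        forall z0, (fun p : nat => iter p F z0) @ \oo --> zs].
Proof.
move=> q0 q1 Fq.
(* Row vectors form a normed module and a complete space; Banach's theorem
   needs the two structures joined. *)
pose X : completeNormedModType R := HB.pack 'rV[R]_m (Complete.on 'rV[R]_m).
pose FX : X -> X := F.
have Ffun : set_fun [set: X] [set: X] FX by [].
pose FF : {fun [set: X] >-> [set: X]} := HB.pack FX (isFun.Build _ _ _ _ FX Ffun).
have [zs _ zsE] : exists2 p, setT p & p = FF p.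
  apply: banach_fixed_point; [|exact: closedT|by exists (0 : X)].
  exists (NngNum q0); split => //= -[z z'] _; exact: Fq.
have fixq z0 p : `|iter p F z0 - zs| <= q ^+ p * `|z0 - zs|.
  elim: p => [|p IH]; first by rewrite expr0 mul1r.
  rewrite iterS [in X in `|X|]zsE (le_trans (Fq _ _))// exprS -mulrA.
  by rewrite ler_wpM2l.
exists zs; split => // [z zE|z0].
  have := Fq z zs; rewrite -zE -[F zs]zsE => le1.
  apply/eqP; rewrite -subr_eq0 -normr_le0; have := normr_ge0 (z - zs).
  nra.
apply/cvgrPdist_lt => e e0.
have /cvgr0_norm_lt cq : (fun p : nat => q ^+ p * `|z0 - zs|) @ \oo --> (0 : R).
  rewrite -[X in _ --> X](mul0r `|z0 - zs|); apply: cvgM; last exact: cvg_cst.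
  by apply: cvg_expr; rewrite ger0_norm.
near=> p; rewrite distrC; apply: le_lt_trans (fixq _ _) _.
apply: le_lt_trans (ler_norm _) _.
by near: p; exact: cq.
Unshelve. all: by end_near. Qed.

End FixedPoint.

(** * Diagonally dominant M-matrices *)

Section MMatrix.
Variables (R : realType) (m : nat) (A : 'M[R]_m).
Hypothesis offdiag : forall i j, i != j -> A i j <= 0.
Hypothesis dominant : forall i, 0 < A i i - \sum_(j | j != i) `|A i j|.

(** At an index i where x is minimal with x_i < 0, the off-diagonal entries being
    nonpositive, (A x)_i <= (A_ii - sum_(j != i) |A_ij|) x_i < 0. *)
Lemma discrete_min_principle (x : 'cV[R]_m) :
  (forall i, 0 <= (A *m x) i 0) -> forall i, 0 <= x i 0.
Proof.
move=> Ax0 i1.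
have [i _ imin] := @arg_minP _ R 'I_m i1 xpredT (fun i => x i 0) isT.
apply: le_trans (imin i1 isT); rewrite leNgt; apply/negP => xi0.
have := Ax0 i; rewrite mxE leNgt => /negP; apply.
rewrite (bigD1 i)//=.
apply: (@le_lt_trans _ _ ((A i i - \sum_(j | j != i) `|A i j|) * x i 0)).
  rewrite mulrBl lerD2l -mulNr -sumrN mulr_suml; apply: ler_sum => j ji.
  have Aij : A i j <= 0 by rewrite offdiag// eq_sym.
  by rewrite ler0_norm// opprK; apply: ler_wnM2l => //; exact: imin.
by rewrite pmulr_rlt0.
Qed.

(** The minimum principle applied to v and - v kills the kernel of A; applied to
    the columns of the inverse, whose images under A are unit vectors, it gives
    the sign of the inverse. *)
Lemma dominant_M_matrix : nonsingular_M_matrix A.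
Proof.
have Aunit : A \in unitmx.
  rewrite -unitmx_tr -row_free_unit; apply/inj_row_free => v vA.
  have vA' : A *m v^T = 0 by rewrite -[A]trmxK -trmx_mul vA trmx0.
  have h1 := @discrete_min_principle v^T.
  have h2 := @discrete_min_principle (- v^T).
  apply/rowP => i; rewrite mxE; apply/eqP; rewrite eq_le.
  have := h1 _ i; have := h2 _ i; rewrite !mxE oppr_ge0 => -> => [->|] //= k.
    by rewrite vA' mxE.
  by rewrite mulmxN vA' !mxE oppr0.
split => // i j.
have := @discrete_min_principle (col j (invmx A)) _ i; rewrite mxE; apply => k.
by rewrite colE mulmxA mulmxV// -colE !mxE ler0n.
Qed.

End MMatrix.

(** * Interpolation weights as barycentric coordinates *)

Section MeshWeights.
Variables (R : realType) (N : nat) (O : set 'rV[R]_N) (h : R) (M : mesh R N).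
Hypothesis M_mesh : mesh_of O h M.
Implicit Type s : {set 'I_(nint M + nbd M)}.

Lemma node_in_hull s i : i \in s -> hull s (node M i).
Proof.
move=> si; exists (fun j => (j == i)%:R); split.
- by move=> j; rewrite ler0n.
- rewrite (bigD1 i)//= eqxx big1 ?addr0// => j /andP[_ /negPf ->] //.
- rewrite (bigD1 i)//= eqxx scale1r big1 ?addr0// => j /andP[_ /negPf ->].
  by rewrite scale0r.
Qed.

Lemma hull_norm_le s x : hull s x -> `|x| <= \sum_(i in s) `|node M i|.
Proof.
move=> [a [a0 a1 ->]]; apply: le_trans (ler_norm_sum _ _ _) _.
apply: ler_sum => i si; rewrite normrZ ger0_norm// ler_piMl//.
by rewrite -a1 (bigD1 i)//= lerDl sumr_ge0.
Qed.

Lemma simplex_diameter s x y :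
  s \in simplices M -> hull s x -> hull s y -> `|x - y| <= h.
Proof.
move=> sM hx hy; case: M_mesh => -[_ <-] _ _ _ _.
apply: le_trans (norm_le_enorm _) _.
apply: (@le_trans _ _ (ediam (hull s))); last first.
  by rewrite /mesh_size (le_bigmax_cond _ (fun s => ediam (hull s))).
apply: ub_le_sup; last by exists x => //; exists y.
exists (Num.sqrt N%:R * (\sum_(i in s) `|node M i| + \sum_(i in s) `|node M i|)).
move=> _ [x' hx' [y' hy' <-]]; apply: le_trans (enorm_le_norm _) _.
rewrite ler_wpM2l ?sqrtr_ge0// (le_trans (ler_normB _ _))//.
by rewrite lerD// hull_norm_le.
Qed.

(** A nodal basis function is affine on each simplex and 0 or 1 at its vertices,
    so at a point sum a_i x_i of the simplex s it equals a_j if j is in s and 0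
    otherwise. *)
Lemma barycentric y : closure O y ->
  exists s, [/\ s \in simplices M, hull s (proj M y),
    forall j, 0 <= basis M j (proj M y),
    forall j, j \notin s -> basis M j (proj M y) = 0 &
    \sum_j basis M j (proj M y) = 1 /\
    proj M y = \sum_j basis M j (proj M y) *: node M j].
Proof.
case: M_mesh => _ _ [Ocov _ _ _] [pM _] nodal; rewrite Ocov => -[s sM sy].
have hy := pM s sM y sy; exists s.
have [a [a0 a1 pE]] := hy.
have bE j : basis M j (proj M y) = if j \in s then a j else 0.
  have [_ aff bn] := nodal j; have [c [d cd]] := aff s sM.
  have -> : basis M j (proj M y) = \sum_(i in s) a i * basis M j (node M i).
    rewrite cd// pE dotp_sumr -[d]mul1r -a1 mulr_suml -big_split/=.
    by apply: eq_bigr => i si; rewrite dotpZr -mulrDr -cd//; exact: node_in_hull.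
  case: ifPn => sj; last first.
    rewrite big1// => i si; rewrite bn; case: eqP => [ij|_]; last by rewrite mulr0.
    by move: sj; rewrite -ij si.
  rewrite (bigD1 j)//= bn eqxx mulr1 big1 ?addr0// => i /andP[_ /negPf ij].
  by rewrite bn ij mulr0.
split => //.
- by move=> j; rewrite bE; case: ifP.
- by move=> j /negPf js; rewrite bE js.
split; first by rewrite (eq_bigr _ (fun j _ => bE j)) -big_mkcond.
rewrite {1}pE big_mkcond; apply: eq_bigr => j _; rewrite bE.
by case: ifP => //; rewrite scale0r.
Qed.

End MeshWeights.

(** * Displacement of the projection *)

Section CoordinateInterpolation.
Variables (R : realType) (N : nat).

Lemma Ck_closure_cst (W : normedModType R) (k : nat) (D : set 'rV[R]_N) (c : W) :
  Ck_closure k D (cst c).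
Proof.
have cont (c' : W) : {within closure D, continuous (cst c' : 'rV[R]_N -> W)}.
  by apply: continuous_subspaceT => x; exact: cst_continuous.
elim: k c => [|k IH] c; split => //.
move=> v; split => [x _|]; first exact: derivable_cst.
by exists (cst 0); split => // x _; rewrite derive_cst.
Qed.

Lemma Ck_closure_coord (k : nat) (D : set 'rV[R]_N) (i : 'I_N) :
  Ck_closure k D (fun x : 'rV[R]_N => x 0 i).
Proof.
have cont : {within closure D, continuous (fun x : 'rV[R]_N => x 0 i)}.
  by apply: continuous_subspaceT => x; exact: coord_continuous.
have der (x v : 'rV[R]_N) : is_derive x v (fun x : 'rV[R]_N => x 0 i) (v 0 i).
  have E : (fun r : R => r^-1 *: ((r *: v + x) 0 i - x 0 i)) @ 0^' --> v 0 i.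
    apply: cvg_near_cst; near=> r.
    rewrite !mxE addrK scalerA mulVf ?scale1r//.
    by near: r; exact: nbhs_dnbhs_neq.
  apply: DeriveDef; first by apply: cvgP E.
  exact: cvg_lim E.
case: k => [|k]; split => // v; split=> [x _|]; first exact: ex_derive.
exists (cst (v 0 i)); split => [x _|]; last exact: Ck_closure_cst.
by rewrite derive_val.
Unshelve. all: by end_near. Qed.

End CoordinateInterpolation.

(** The interpolant of the i-th coordinate function is the i-th coordinate of
    p_h, because p_h(y) is the barycentre of the nodes with the interpolation
    weights; the interpolation estimate for the N coordinate functions is
    therefore an estimate of p_h - id. *)
Lemma proj_displacement (R : realType) (N : nat) (O : set 'rV[R]_N)
    (H : set R) (M : R -> mesh R N) :
  (forall h, H h -> mesh_of O h (M h)) ->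
  interpolation_estimate O H M ->
  exists2 C : R, 0 <= C & forall h, H h -> forall y, closure O y ->
    `|proj (M h) y - y| <= C * h ^+ 2.
Proof.
move=> M_mesh M_interp.
have /choice[C CP] : forall i : 'I_N, exists C : R, forall h, H h ->
    forall y, closure O y -> `|proj (M h) y 0 i - y 0 i| <= C * h ^+ 2.
  move=> i; have [C CP] := M_interp _ (@Ck_closure_coord R N 2 O i).
  exists C => h Hh y Oy; have := CP h Hh y Oy; rewrite /interpolant.
  have [_ [_ _ _ _ [_ pE]]] := barycentric (M_mesh h Hh) Oy.
  by rewrite [in X in _ -> X]pE summxE; under [in X in _ -> X]eq_bigr do rewrite mxE.
exists (\sum_i `|C i|) => [|h Hh y Oy]; first exact: sumr_ge0.
apply: norm_le_coord => [|i].
  by rewrite mulr_ge0 ?sumr_ge0// sqr_ge0.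
rewrite !mxE (le_trans (CP i h Hh y Oy))// ler_wpM2r ?sqr_ge0//.
by rewrite (le_trans (ler_norm _))// (bigD1 i)//= lerDl sumr_ge0.
Qed.

(** * Strict differentiability of C^1 functions *)

Section StrictDifferentiability.
Variables (R : realType) (N : nat).
Implicit Types (w x y z : 'rV[R]_N) (rho : 'rV[R]_N -> R).

Lemma is_derive_line rho w (i : 'I_N) (s : R) :
  derivable rho (w + s *: delta_mx 0 i) (delta_mx 0 i) ->
  is_derive s 1 (fun s : R => rho (w + s *: delta_mx 0 i))
    ('D_(delta_mx 0 i) rho (w + s *: delta_mx 0 i)).
Proof.
set v := delta_mx 0 i; set p := w + s *: v => dp.
have qE : (fun r : R => r^-1 *: (rho (w + (r *: 1 + s) *: v) - rho p)) =
          (fun r : R => r^-1 *: ((rho \o shift p) (r *: v) - rho p)).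
  apply/funext => r /=; rewrite /p; congr (_ *: (rho _ - _)).
  by rewrite [r *: 1]mulr1 scalerDl addrCA.
apply: DeriveDef; rewrite /derivable /derive /= /shift /= qE; first exact: dp.
by [].
Qed.

(** The mean value theorem along one coordinate axis: the segment from w to
    w + c e_i stays in the ball, where the partial derivative varies by at most
    eps. *)
Lemma partial_increment rho (x0 : 'rV[R]_N) (delta eps : R) (i : 'I_N) w (c : R) :
  (forall y : 'rV[R]_N, `|y - x0| < delta -> derivable rho y (delta_mx 0 i) /\
     `|'D_(delta_mx 0 i) rho y - 'D_(delta_mx 0 i) rho x0| <= eps) ->
  `|w - x0| < delta -> `|w + c *: delta_mx 0 i - x0| < delta ->
  `|rho (w + c *: delta_mx 0 i) - rho w - 'D_(delta_mx 0 i) rho x0 * c|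
     <= eps * `|c|.
Proof.
set v := delta_mx 0 i => Hd.
wlog c0 : w c / 0 <= c.
  move=> wl wd w'd; have [c0|/ltW c0] := leP 0 c; first exact: wl.
  have wE : w + c *: v + (- c) *: v = w by rewrite scaleNr addrK.
  have := wl (w + c *: v) (- c); rewrite oppr_ge0 wE => /(_ c0 w'd wd).
  rewrite normrN => h; rewrite -normrN; apply: le_trans h.
  by rewrite le_eqVlt; apply/orP; left; apply/eqP; congr `|_|; ring.
move=> wd w'd.
have inball s : 0 <= s <= c -> `|w + s *: v - x0| < delta.
  move=> /andP[s0 sc].
  apply: (@le_lt_trans _ _ (Num.max `|w - x0| `|w + c *: v - x0|)); last first.
    by rewrite gt_max wd w'd.
  apply: norm_le_coord => [|j]; first by rewrite le_max normr_ge0.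
  have h1 := coord_le_norm (w - x0) j.
  have h2 := coord_le_norm (w + c *: v - x0) j.
  rewrite le_max; move: h1 h2; rewrite !mxE eqxx /=.
  have [_|_] := eqVneq j i; rewrite ?mulr1 ?mulr0 ?addr0; last by move=> ->.
  set a := w 0 j - x0 0 j; rewrite ![w 0 j + _ - _]addrAC -/a => h1 h2.
  have [as0|as0] := leP 0 (a + s).
    apply/orP; right; apply: le_trans h2; rewrite !ger0_norm//; lra.
  apply/orP; left; apply: le_trans h1; rewrite !ler0_norm//; lra.
pose f (s : R) := rho (w + s *: v); pose df (s : R) := 'D_v rho (w + s *: v).
have der s : s \in `[0, c] -> is_derive s 1 f (df s).
  move=> /itvP sI; apply: is_derive_line.
  by have [] := Hd _ (inball s _); rewrite ?sI.
have deroo s : s \in `]0, c[ -> is_derive s 1 f (df s).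
  by move=> sI; apply: der; exact: subset_itv_oo_cc sI.
have fcont : {within `[0, c], continuous f}.
  by apply: derivable_within_continuous => s /der ds; exact: ex_derive.
have [s /itvP sI] := MVT_segment c0 deroo fcont.
rewrite /f scale0r addr0 subr0 => ->; rewrite -mulrBl normrM ler_wpM2r//.
by have [] := Hd _ (inball s _); rewrite ?sI.
Qed.

(** Going from x to z one coordinate at a time keeps the intermediate points in
    the ball of the maximum norm, so the estimate follows by telescoping from
    the one-dimensional increments. *)
Lemma strictly_differentiable rho (x0 : 'rV[R]_N) (U : set 'rV[R]_N) (eps : R) :
  open_nbhs x0 U -> Ck 1 U rho -> 0 < eps ->
  exists delta : R, [/\ 0 < delta, forall y : 'rV[R]_N, `|y - x0| < delta -> U y &
    forall x z : 'rV[R]_N, `|x - x0| < delta -> `|z - x0| < delta ->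
      `|rho z - rho x - dotp (grad rho x0) (z - x)| <= eps * `|z - x|].
Proof.
move=> [Uopen Ux0] [_ Ck1] eps0.
(* Each of the N coordinate steps may cost e |z - x|; dividing by N + 1 keeps
   the quotient meaningful for N = 0. *)
pose e : R := eps / N.+1%:R.
have e0 : 0 < e by rewrite divr_gt0.
have nearU : nbhs x0 U by exact: open_nbhs_nbhs.
pose D (i : 'I_N) (y : 'rV[R]_N) : R := 'D_(delta_mx 0 i) rho y.
have nearD : nbhs x0 (fun y : 'rV[R]_N => forall i, `|D i y - D i x0| <= e).
  apply: (filter_forall (nbhs_filter x0)) => i.
  have [_ [cont _]] := Ck1 (delta_mx 0 i).
  have /cvgrPdist_le /(_ e e0) := cont x0 Ux0.
  by apply: filterS => y; rewrite distrC.
have nearUD : nbhs x0 (fun y : 'rV[R]_N =>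
    U y /\ forall i, `|D i y - D i x0| <= e).
  exact: filterI nearU nearD.
have [delta /= delta0 ball_sub] := (nbhs_ballP _ _).1 nearUD.
have near_x0 y : `|y - x0| < delta -> U y /\ forall i : 'I_N,
    `|'D_(delta_mx 0 i) rho y - 'D_(delta_mx 0 i) rho x0| <= e.
  by move=> yd; apply: ball_sub; rewrite -ball_normE /= distrC.
exists delta; split => // [y /near_x0[]//|x z xd zd].
pose w (k : nat) : 'rV[R]_N := \row_j (if (j < k)%N then z 0 j else x 0 j).
have w0 : w 0 = x by apply/rowP => j; rewrite mxE.
have wN : w N = z by apply/rowP => j; rewrite mxE ltn_ord.
have wS (i : 'I_N) : w i.+1 = w i + (z - x) 0 i *: delta_mx 0 i.
  apply/rowP => j; rewrite !mxE eqxx /= ltnS.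
  have [->|ji] := eqVneq j i; first by rewrite leqnn ltnn mulr1 addrC subrK.
  by rewrite mulr0 addr0 leq_eqVlt (negPf (ji : (j : nat) != i)).
have wd k : `|w k - x0| < delta.
  apply: (@le_lt_trans _ _ (Num.max `|x - x0| `|z - x0|)); last first.
    by rewrite gt_max xd zd.
  apply: norm_le_coord => [|j]; first by rewrite le_max normr_ge0.
  have := coord_le_norm (x - x0) j; have := coord_le_norm (z - x0) j.
  by rewrite le_max !mxE; case: ifP => _ hz hx; rewrite ?hz ?hx ?orbT.
have -> : rho z - rho x - dotp (grad rho x0) (z - x) =
    \sum_(i < N) (rho (w i.+1) - rho (w i)
                  - 'D_(delta_mx 0 i) rho x0 * (z - x) 0 i).
  rewrite sumrB -(big_mkord xpredT (fun k => rho (w k.+1) - rho (w k))).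
  rewrite telescope_sumr// w0 wN; congr (_ - _).
  by apply: eq_bigr => i _; rewrite !mxE.
apply: le_trans (ler_norm_sum _ _ _) _.
apply: (@le_trans _ _ (\sum_(i < N) e * `|z - x|)).
  apply: ler_sum => i _; apply: (@le_trans _ _ (e * `|(z - x) 0 i|)).
    have wd' := wd i.+1; rewrite wS in wd'; rewrite wS.
    apply: partial_increment wd' => // y yd.
    have [Uy Dy] := near_x0 y yd; split; last exact: Dy.
    by have [der _] := Ck1 (delta_mx 0 i); exact: der.
  by rewrite ler_wpM2l ?coord_le_norm// ltW.
rewrite sumr_const card_ord -mulrnAl ler_wpM2r// -mulr_natr /e.
by rewrite -mulrA ler_piMr ?ltW// mulrC ltr_pdivrMr ?ltr0n// mul1r ltr_nat.
Qed.

End StrictDifferentiability.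

(** * Local geometry of the boundary *)

Section LocalGeometry.
Variables (R : realType) (N : nat) (O : set 'rV[R]_N).
Hypothesis O_open : open O.

Lemma bdry_compact : bounded_set O -> compact (bdry O).
Proof.
move=> O_bounded; apply: bounded_closed_compact.
  have [r r0 Or] := ex_strict_bound_gt0 O_bounded.
  have clO : closure O `<=` [set x : 'rV[R]_N | `|x| <= r].
    have : closed [set x : 'rV[R]_N | `|x| <= r].
      exact: preimage_closed (fun x _ => @norm_continuous _ _ x) (@closed_le R r).
    move=> /closure_id ->; apply: closure_subset => x Ox /=.
    by apply: ltW; exact: Or.
  exists r; split; first exact: num_real.
  by move=> M rM x [/clO /= xr _]; apply: le_trans xr (ltW rM).
rewrite /bdry setDE; apply: closedI; first exact: closed_closure.
by apply: open_closedC; exact: open_interior.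
Qed.

(** O being open, z is not in O, so rho z >= 0; z is a limit of points of O,
    where rho < 0, so rho z <= 0 by continuity. *)
Lemma bdry_zero k x0 U rho z : defining_function k O x0 U rho ->
  bdry O z -> U z -> rho z = 0.
Proof.
move=> [[Uopen _] CkU inO _] [clz niz] Uz.
have rho_cont : {for z, continuous rho} by case: k CkU => [|k] [+ _]; exact.
apply/eqP; rewrite eq_le; apply/andP; split; last first.
  rewrite leNgt; apply/negP => /(inO _ Uz) Oz; apply: niz.
  exact: open_nbhs_nbhs (conj O_open Oz).
rewrite leNgt; apply/negP => rz.
have nearpos : nbhs z (fun y => 0 < rho y).
  exact: cvgr_gt rho_cont 0 rz.
have nearU := open_nbhs_nbhs (conj Uopen Uz).
have [y [Oy [rho_y Uy]]] := clz _ (filterI nearpos nearU).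
by have := (inO y Uy).1 Oy; rewrite ltNge ltW.
Qed.

(** Positivity at x0 spreads to a neighbourhood of x0 with a constant that does
    not depend on b, by compactness of B; the near-covering form of compactness
    is applied with the pair (x, c) as parameter, x tending to x0 and c to 0
    from above. *)
Lemma oblique_near (NB : nat) (B V : set 'rV[R]_NB)
    (gamma : 'rV[R]_N * 'rV[R]_NB -> 'rV[R]_N) (x0 G : 'rV[R]_N) :
  compact B -> open V -> B `<=` V -> Ck_rel 1 (bdry O `*` V) gamma ->
  bdry O x0 -> (forall b, B b -> 0 < dotp G (gamma (x0, b))) ->
  exists delta c : R, [/\ 0 < delta, 0 < c &
    forall x b, bdry O x -> `|x - x0| < delta -> B b ->
      c <= dotp G (gamma (x, b))].
Proof.
move=> Bc Vo BV gC Ox0 Gpos.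
pose P (i : 'rV[R]_N * R) (b : 'rV[R]_NB) :=
  bdry O i.1 -> i.2 <= dotp G (gamma (i.1, b)).
pose F := filter_prod (nbhs x0) (0^'+ : set_system R).
have FF : Filter F by exact: filter_prod_filter.
have /near_covering_withinP cov : near_covering B by apply/compact_near_coveringP.
have : \near F, B `<=` P F.
  apply: cov => b Bb.
  have [D [Fg [[Dopen Dp] [FC _] FE]]] := gC (x0, b) (conj Ox0 (BV _ Bb)).
  have dcont : {for (x0, b), continuous (fun q => dotp G (Fg q))}.
    apply: continuous_comp; first exact: FC.
    exact: continuous_dotp.
  have d0 := Gpos b Bb; set d := dotp _ _ in d0.
  have dE : dotp G (Fg (x0, b)) = d by rewrite FE//; split => //; exact: BV.
  have lt2 : d / 2 < dotp G (Fg (x0, b)) by rewrite dE; lra.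
  have nearq : nbhs (x0, b) (fun q => d / 2 < dotp G (Fg q)).
    exact: cvgr_gt dcont _ lt2.
  have [[A1 A2] [/= A1x A2b] A12] :=
    filterI nearq (open_nbhs_nbhs (conj Dopen Dp)).
  exists (A2, A1 `*` [set c : R | c < d / 2]).
    split => //=; exists (A1, [set c : R | c < d / 2]) => //; split => //=.
    by apply: nbhs_right_lt; lra.
  move=> [b' [x c]] [/= A2b' [/= A1x' cd]] Bb' /= Ox.
  have [/= lt3 Dxb] := A12 (x, b') (conj A1x' A2b').
  rewrite -FE//; last by split => //; exact: BV.
  by apply: ltW; exact: lt_trans lt3.
move=> [[A C] [/= Ax Cc] AC].
have [delta /= delta0 Adelta] := (nbhs_ballP _ _).1 Ax.
have [c [Cc' c0]] : exists c : R, C c /\ 0 < c.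
  apply: (@filter_ex _ (0^'+ : set_system R)).
  by apply: filterI => //; exact: nbhs_right_gt.
exists delta, c; split => // x b Ox xd Bb.
apply: (AC (x, c)) => //; split => //=.
by apply: Adelta; rewrite -ball_normE /= distrC.
Qed.

End LocalGeometry.

(** * Lower bound for the interior weights *)

Section InteriorWeight.
Variables (R : realType) (N NB : nat) (O : set 'rV[R]_N) (h l : R).
Variables (M : mesh R N) (gamma : 'rV[R]_N * 'rV[R]_NB -> 'rV[R]_N).
Hypothesis M_mesh : mesh_of O h M.
Variables (i : 'I_(nbd M)) (b : 'rV[R]_NB).
Let x := bnode i.
Let y := offset_point l gamma i b.
Hypothesis y_in : closure O y.

Lemma weight_ge0 j : 0 <= weight l gamma i b j.
Proof. by have [s [_ _ + _ _]] := barycentric M_mesh y_in; apply. Qed.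

Lemma weight_sum :
  \sum_j weight_int l gamma i b j + \sum_j weight_bd l gamma i b j = 1.
Proof.
have [s [_ _ _ _ [<- _]]] := barycentric M_mesh y_in.
by rewrite big_split_ord.
Qed.

(** Test the weights at y against the affine function v(z) = - <G, z - x>.  The
    left-hand side bounds v(y) from below; on the right, the first term bounds
    the contribution of the boundary nodes, the second the error
    v(y) - v(p_h(y)), the third the contribution of the interior nodes. *)
Lemma interior_weight_bound (G : 'rV[R]_N) (c eps C K : R) :
  0 <= h -> 0 <= l -> 0 <= eps -> 0 <= K ->
  c <= dotp G (gamma (x, b)) ->
  `|proj M y - y| <= C * h ^+ 2 ->
  h + C * h ^+ 2 + `|y - x| <= K * h ->
  (forall z, bdry O z -> `|z - x| <= K * h ->
     `|dotp G (z - x)| <= eps * `|z - x|) ->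
  l * c <= eps * (K * h) + (\sum_k `|G 0 k|) * (C * h ^+ 2)
           + (\sum_k `|G 0 k|) * (K * h) * \sum_j weight_int l gamma i b j.
Proof.
move=> h0 l0 eps0 K0 cG pd Kh flat.
set S := \sum_k `|G 0 k|.
have [s [sM hp w0 ws [w1 pE]]] := barycentric M_mesh y_in.
pose w j := weight l gamma i b j.
have close j : w j != 0 -> `|node M j - x| <= K * h.
  move=> wj; have js : j \in s by apply: contraNT wj => /ws /eqP.
  apply: le_trans Kh.
  apply: le_trans (ler_distD (proj M y) _ _) _.
  rewrite -addrA; apply: lerD.
    by apply: (simplex_diameter M_mesh sM) => //; exact: node_in_hull.
  by apply: le_trans (ler_distD y _ _) _; rewrite lerD2r.
have S0 : 0 <= S by exact: sumr_ge0.
have Kh0 : 0 <= K * h by rewrite mulr_ge0.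
have ylin : l * dotp G (gamma (x, b)) = - dotp G (y - x).
  by rewrite /y /offset_point -/x !dotpBr dotpZr; ring.
have plin : dotp G (proj M y - x) = \sum_j w j * dotp G (node M j - x).
  rewrite [X in dotp G X](_ : _ = \sum_j w j *: (node M j - x)); last first.
    under eq_bigr do rewrite scalerBr; rewrite sumrB -pE -scaler_suml.
    by rewrite [X in X *: x]w1 scale1r.
  by rewrite dotp_sumr; apply: eq_bigr => j _; rewrite dotpZr.
have step1 : l * c <= - (\sum_j w j * dotp G (node M j - x)) + S * (C * h ^+ 2).
  apply: (@le_trans _ _ (l * dotp G (gamma (x, b)))); first by rewrite ler_wpM2l.
  rewrite ylin -plin; have := dotp_le G (proj M y - y); rewrite -/S.
  have := ler_wpM2l S0 pd.
  have -> : dotp G (y - x) = dotp G (proj M y - x) - dotp G (proj M y - y).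
    by rewrite !dotpBr; ring.
  have := ler_norm (dotp G (proj M y - y)); lra.
apply: le_trans step1 _.
rewrite [leRHS]addrAC lerD2r -sumrN big_split_ord /= addrC lerD//.
- apply: (@le_trans _ _ (\sum_(j < nbd M) w (rshift (nint M) j) * (eps * (K * h)))).
    apply: ler_sum => j _; rewrite -mulrN.
    have [->|wj] := eqVneq (w (rshift (nint M) j)) 0; first by rewrite !mul0r.
    rewrite ler_wpM2l ?weight_ge0//.
    have Kj := close _ wj.
    have bj : bdry O (node M (rshift (nint M) j)) by case: M_mesh => _ [_ +] _ _ _.
    apply: le_trans (ler_norm _) _; rewrite normrN.
    by apply: le_trans (flat _ bj Kj) _; rewrite ler_wpM2l.
  rewrite -mulr_suml ler_piMl ?mulr_ge0// -weight_sum lerDr.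
  by apply: sumr_ge0 => j _; exact: weight_ge0.
- rewrite mulr_sumr; apply: ler_sum => j _; rewrite -mulrN mulrC.
  rewrite -[weight_int _ _ _ _ j]/(w (lshift (nbd M) j)).
  have [->|wj] := eqVneq (w (lshift (nbd M) j)) 0; first by rewrite !mulr0.
  rewrite ler_wpM2r ?weight_ge0//.
  apply: le_trans (ler_norm _) _; rewrite normrN.
  by apply: le_trans (dotp_le _ _) _; rewrite ler_wpM2l// close.
Qed.

End InteriorWeight.

Section UniformInteriorWeight.
Variables (R : realType) (N NB : nat) (O : set 'rV[R]_N).
Variables (n : 'rV[R]_N -> 'rV[R]_N) (B V : set 'rV[R]_NB).
Variables (gamma : 'rV[R]_N * 'rV[R]_NB -> 'rV[R]_N).
Variables (H : set R) (M : R -> mesh R N) (c0 c1 : R) (l : R -> R).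
Hypothesis O_open : open O.
Hypothesis n_normal : forall x, bdry O x -> outward_unit_normal O x (n x).
Hypothesis B_compact : compact B.
Hypothesis V_open : open V.
Hypothesis B_sub_V : B `<=` V.
Hypothesis gamma_C1 : Ck_rel 1 (bdry O `*` V) gamma.
Hypothesis gamma_unit :
  forall x b, bdry O x -> B b -> enorm (gamma (x, b)) = 1.
Hypothesis gamma_oblique :
  forall x b, bdry O x -> B b -> 0 < dotp (n x) (gamma (x, b)).
Hypothesis H_gt0 : forall h, H h -> 0 < h.
Hypothesis M_mesh : forall h, H h -> mesh_of O h (M h).
Hypothesis M_interp : interpolation_estimate O H M.
Hypothesis c0_gt0 : 0 < c0.
Hypothesis l_bounds : forall h, H h -> c0 * h <= l h <= c1 * h.

(** The parameter r plays two roles, the largest admissible mesh size and the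
    lower bound for the interior weight, so that uniformity over the boundary is
    a statement about a single parameter tending to 0 from above. *)
Definition good_offset (r : R) (x : 'rV[R]_N) : Prop :=
  forall h, H h -> h <= r -> forall (i : 'I_(nbd (M h))) b,
    bnode i = x -> B b ->
    closure O (offset_point (l h) gamma i b) /\
    r <= \sum_j weight_int (l h) gamma i b j.

(** Divide the bound of [interior_weight_bound] by h: the left-hand side is at
    least c0 c, the boundary term is at most c0 c / 4 by the choice of eps, and
    the projection error at most c0 c / 4 for small h, which leaves at least
    c0 c / 2 for the interior nodes.  The offset point is in O because rho
    decreases from 0 at a rate of at least c / 2 along - gamma. *)
Lemma good_offset_near (x0 : 'rV[R]_N) : bdry O x0 ->
  exists delta r1 : R, [/\ 0 < delta, 0 < r1 &
    forall x r, `|x - x0| < delta -> 0 < r -> r <= r1 -> good_offset r x].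
Proof.
move=> Ox0.
have [U [rho [def_rho nE]]] := n_normal Ox0.
have [Unbhs CkU inO _] := def_rho.
set G := grad rho x0 in nE.
have Gpos b : B b -> 0 < dotp G (gamma (x0, b)).
  move=> Bb; have := gamma_oblique Ox0 Bb; rewrite nE dotpZl => d0.
  rewrite ltNge; apply/negP => dle0; move: d0; rewrite ltNge => /negP; apply.
  by rewrite mulr_ge0_le0// invr_ge0 sqrtr_ge0.
have [d1 [c [d1_gt0 c_gt0 oblique]]] :=
  oblique_near B_compact V_open B_sub_V gamma_C1 Ox0 Gpos.
have [C C0 CP] := proj_displacement M_mesh M_interp.
(* Nodes of positive weight are within h + C h^2 + c1 h <= K h of the boundary
   node, as soon as C h <= 1. *)
pose K := 2 + Num.max c1 0.
have K2 : 2 <= K by rewrite /K lerDl le_max lexx orbT.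
have c1K : c1 <= K - 2 by rewrite /K addrAC subrr add0r le_max lexx.
have K0 : 0 < K by lra.
(* The first bound makes the boundary nodes negligible, the second puts the
   offset point inside O. *)
pose eps := Num.min (c0 * c / (4 * K)) (c / 2).
have cc0 : 0 < c0 * c by rewrite mulr_gt0.
have eps0 : 0 < eps by rewrite lt_min !divr_gt0// mulr_gt0.
have epsK : eps * K <= c0 * c / 4.
  by rewrite -ler_pdivlMr// /eps invfM mulrA ge_min lexx.
have epsc : eps <= c / 2 by rewrite ge_min lexx orbT.
have [d2 [d2_gt0 d2U diff]] := strictly_differentiable Unbhs CkU eps0.
pose d := Num.min d1 d2.
have d0 : 0 < d by rewrite lt_min d1_gt0.
have dd1 : d <= d1 by rewrite ge_min lexx.
have dd2 : d <= d2 by rewrite ge_min lexx orbT.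
pose S := \sum_k `|G 0 k|.
have S0 : 0 <= S by exact: sumr_ge0.
(* Mesh sizes up to r1 satisfy, in this order: K h <= d / 4, C h <= 1,
   S C h <= c0 c / 4 and S K r1 < c0 c / 2. *)
pose r1 := Num.min (Num.min (d / (4 * K)) (C + 1)^-1)
  (Num.min (c0 * c / (4 * (S * C + 1))) (c0 * c / (4 * (S * K + 1)))).
have SC0 : 0 < S * C + 1 by rewrite ltr_wpDl// mulr_ge0.
have SK0 : 0 < S * K + 1 by rewrite ltr_wpDl// mulr_ge0// ltW.
have C10 : 0 < C + 1 by rewrite ltr_wpDl.
exists (d / 2), r1; split; first by rewrite divr_gt0.
  by rewrite !lt_min invr_gt0 C10 !divr_gt0// mulr_gt0.
move=> x r xd r_gt0; rewrite !le_min => /andP[/andP[rK rC] /andP[rSC rSK]].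
move=> h Hh hr i b xE Bb; subst x; set x := bnode i in xd *.
have h0 := H_gt0 Hh.
have /andP[l_ge l_le] := l_bounds Hh.
have l0 : 0 < l h by apply: lt_le_trans l_ge; rewrite mulr_gt0.
have Ox : bdry O x by case: (M_mesh Hh) => _ [_ +] _ _ _; exact.
have KhE : K * h <= d / 4.
  apply: (@le_trans _ _ (K * (d / (4 * K)))).
    by rewrite (ler_wpM2l (ltW K0))// (le_trans hr).
  by rewrite le_eqVlt; apply/orP; left; apply/eqP; field; rewrite gt_eqF.
have Ch1 : C * h <= 1.
  apply: (@le_trans _ _ ((C + 1) * (C + 1)^-1)); last by rewrite divff// gt_eqF.
  by apply: ler_pM => //; [exact: ltW|rewrite lerDl|exact: le_trans hr rC].
have SCh : S * C * h <= c0 * c / 4.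
  have := le_trans hr rSC; rewrite ler_pdivlMr ?mulr_gt0// => hSC.
  have : 0 <= S * C * h by rewrite !mulr_ge0// ltW.
  lra.
have SKr : S * K * r < c0 * c / 2.
  move: rSK; rewrite ler_pdivlMr ?mulr_gt0// => hSK.
  have : 0 <= S * K * r by rewrite !mulr_ge0// ltW.
  lra.
set y := offset_point (l h) gamma i b.
have yxE : y - x = - (l h *: gamma (x, b)).
  by rewrite /y /offset_point -/x addrAC subrr add0r.
have yx : `|y - x| <= l h.
  rewrite yxE normrN normrZ (gtr0_norm l0) ler_piMr ?(ltW l0)//.
  by rewrite -(gamma_unit Ox Bb) norm_le_enorm.
have lKh : l h <= (K - 2) * h by rewrite (le_trans l_le)// ler_wpM2r// ltW.
have near_x z : `|z - x| <= K * h -> `|z - x0| < d.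
  move=> zx; apply: le_lt_trans (ler_distD x _ _) _.
  lra.
have xd' : `|x - x0| < d by lra.
have yd : `|y - x0| < d by apply: near_x; lra.
have cG : c <= dotp G (gamma (x, b)) by apply: oblique => //; lra.
have rhox : rho x = 0.
  by apply: (bdry_zero O_open def_rho) => //; apply: d2U; lra.
have Oy : closure O y.
  apply: subset_closure; apply/(inO y).
    by apply: d2U; lra.
  have GyxE : dotp G (y - x) = - (l h * dotp G (gamma (x, b))).
    by rewrite yxE -scaleN1r !dotpZr mulN1r.
  have dy := diff x y (lt_le_trans xd' dd2) (lt_le_trans yd dd2).
  rewrite rhox subr0 -/G GyxE opprK in dy.
  have le_y := le_trans (ler_norm _) dy.
  have le_eps : eps * `|y - x| <= c / 2 * l h.
    by apply: ler_pM => //; exact: ltW.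
  have le_G : l h * c <= l h * dotp G (gamma (x, b)) by rewrite ler_wpM2l// ltW.
  have lc0 : 0 < l h * c by rewrite mulr_gt0.
  lra.
split => //.
have flat z : bdry O z -> `|z - x| <= K * h ->
    `|dotp G (z - x)| <= eps * `|z - x|.
  move=> Oz zx; have zd := near_x z zx.
  have := diff x z (lt_le_trans xd' dd2) (lt_le_trans zd dd2).
  rewrite rhox (bdry_zero O_open def_rho Oz); last by apply: d2U; lra.
  by rewrite subrr sub0r normrN.
have hK : h + C * h ^+ 2 + `|y - x| <= K * h.
  have : C * h * h <= 1 * h by rewrite ler_wpM2r// ltW.
  rewrite expr2; lra.
have bound := interior_weight_bound (M_mesh Hh) Oy (ltW h0) (ltW l0)
  (ltW eps0) (ltW K0) cG (CP h Hh y Oy) hK flat.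
rewrite -/S in bound; set W := \sum_j _ in bound *.
have bound' : c0 * c <= eps * K + S * C * h + S * K * W.
  rewrite -(ler_pM2r h0); have : c0 * h * c <= l h * c by rewrite ler_wpM2r// ltW.
  lra.
rewrite leNgt; apply/negP => Wr.
have : S * K * W <= S * K * r by rewrite ler_wpM2l ?mulr_ge0// ltW.
lra.
Qed.

(** Near-covering compactness of the boundary, with the parameter of
    [good_offset] tending to 0 from above. *)
Lemma uniform_interior_weight : bounded_set O ->
  exists2 r : R, 0 < r & forall x, bdry O x -> good_offset r x.
Proof.
move=> O_bounded.
have /compact_near_coveringP cov := bdry_compact O_bounded.
have near0 : (0^'+ : set_system R) (fun r => bdry O `<=` good_offset r).
  apply: (cov R (0^'+ : set_system R) good_offset) => x0.
  move=> /good_offset_near[d [r1 [d0 r10 good]]].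
  exists ([set x | `|x - x0| < d], [set r | 0 < r /\ r <= r1]).
    split => /=; last first.
      by apply: filterI; [exact: nbhs_right_gt|exact: nbhs_right_le].
    by apply/nbhs_ballP; exists d => //= z; rewrite -ball_normE /= distrC.
  by move=> [x r] [/= xd [r0 rr1]]; exact: good.
have [r [good r0]] := @filter_ex _ (0^'+ : set_system R) _ _
  (filterI near0 (nbhs_right_gt (0 : R))).
by exists r.
Qed.

End UniformInteriorWeight.

(** * The boundary scheme for a fixed mesh *)

Section Scheme.
Variables (R : realType) (N NB : nat) (O : set 'rV[R]_N) (h l t theta : R).
Variables (M : mesh R N) (B : set 'rV[R]_NB).
Variables (gamma : 'rV[R]_N * 'rV[R]_NB -> 'rV[R]_N).
Variables (g k : R -> 'rV[R]_N -> 'rV[R]_NB -> R).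
Hypothesis M_mesh : mesh_of O h M.
Hypothesis l_gt0 : 0 < l.
Hypothesis theta_gt0 : 0 < theta.
Hypothesis offset_in : forall (i : 'I_(nbd M)) b,
  B b -> closure O (offset_point l gamma i b).
Hypothesis theta_le : forall (i : 'I_(nbd M)) b,
  B b -> theta <= \sum_j weight_int l gamma i b j.
Hypothesis k_ge0 : forall (i : 'I_(nbd M)) b, B b -> 0 <= k t (bnode i) b.

Let weight_bd_ge0 (i j : 'I_(nbd M)) b : B b -> 0 <= weight_bd l gamma i b j.
Proof. by move=> Bb; apply: (weight_ge0 M_mesh); exact: offset_in. Qed.

Let denom_ge1 (i : 'I_(nbd M)) b : B b -> 1 <= 1 + l * k t (bnode i) b.
Proof. by move=> Bb; rewrite lerDl mulr_ge0 ?k_ge0// ltW. Qed.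

Let sum_weight_bd_le (i : 'I_(nbd M)) b :
  B b -> \sum_j weight_bd l gamma i b j <= 1 - theta.
Proof.
move=> Bb; have := weight_sum M_mesh (@offset_in i _ Bb).
by have := @theta_le i _ Bb; lra.
Qed.

Let ratio (i : 'I_(nbd M)) b :=
  (\sum_j weight_bd l gamma i b j) / (1 + l * k t (bnode i) b).

Let ratio_ge0 i b : B b -> 0 <= ratio i b.
Proof.
move=> Bb; rewrite divr_ge0 ?sumr_ge0// => [j _|]; first exact: weight_bd_ge0.
exact: le_trans (@denom_ge1 i _ Bb).
Qed.

Let ratio_le i b : B b -> ratio i b <= 1 - theta.
Proof.
move=> Bb; rewrite ler_pdivrMr ?(lt_le_trans ltr01 (@denom_ge1 i _ Bb))//.
apply: le_trans (@sum_weight_bd_le i _ Bb) _; rewrite ler_peMr ?denom_ge1//.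
apply: le_trans (@sum_weight_bd_le i _ Bb); rewrite sumr_ge0// => j _.
exact: weight_bd_ge0.
Qed.

Let L := Tn_lipschitz_const M l t gamma k B.

Let ratio_le_L i b : B b -> ratio i b <= L.
Proof.
move=> Bb; apply: ub_le_sup; last by exists i => //; exists b.
by exists (1 - theta) => _ [i' _ [b' Bb' <-]]; exact: ratio_le.
Qed.

(** Without boundary nodes the constant is the supremum of the empty set, 0. *)
Lemma Tn_lipschitz_const_ge0 : 0 <= L.
Proof.
rewrite /L /Tn_lipschitz_const; set E := (X in sup X).
have [->|/set0P[_ [i _ [b Bb _]]]] := eqVneq E set0; first by rewrite sup0.
exact: le_trans (@ratio_ge0 i _ Bb) (@ratio_le_L i _ Bb).
Qed.

Lemma Tn_lipschitz_const_le : theta <= 1 -> L <= 1 - theta.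
Proof.
move=> theta1; rewrite /L /Tn_lipschitz_const; set E := (X in sup X).
have [->|E0] := eqVneq E set0; first by rewrite sup0 subr_ge0.
apply: ge_sup; first exact/set0P.
by move=> _ [i _ [b Bb <-]]; exact: ratio_le.
Qed.

(** For fixed b the quotients are affine in z with nonnegative coefficients, and
    the values at the interior nodes and g cancel in the difference. *)
Lemma Tn_lipschitz (Vint : 'rV[R]_(nint M)) (z z' : 'rV[R]_(nbd M)) :
  B !=set0 ->
  `|Tn l t gamma g k B Vint z - Tn l t gamma g k B Vint z'| <= L * `|z - z'|.
Proof.
move=> B0; apply: norm_le_coord => [|i].
  by rewrite mulr_ge0 ?Tn_lipschitz_const_ge0.
rewrite !mxE; apply: le_dist_inf => // b Bb.
rewrite -mulrBl (_ : _ - _ = \sum_j weight_bd l gamma i b j * (z - z') 0 j).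
  have d0 := lt_le_trans ltr01 (@denom_ge1 i _ Bb).
  rewrite normrM [`|_^-1|]gtr0_norm ?invr_gt0//.
  apply: (@le_trans _ _ (ratio i b * `|z - z'|)); last first.
    by rewrite ler_wpM2r ?ratio_le_L.
  rewrite /ratio mulrAC ler_wpM2r ?invr_ge0 ?(ltW d0)// mulr_suml.
  apply: le_trans (ler_norm_sum _ _ _) _; apply: ler_sum => j _.
  rewrite normrM ger0_norm ?weight_bd_ge0//.
  by rewrite ler_wpM2l ?weight_bd_ge0 ?coord_le_norm.
under [RHS]eq_bigr do rewrite !mxE mulrBr.
by rewrite sumrB; ring.
Qed.

Variable b : 'rV[R]_NB.
Hypothesis Bb : B b.
Let A := boundary_matrix M l t gamma k b.

Let offdiag i j : i != j -> A i j = - weight_bd l gamma i b j.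
Proof. by move=> /negPf ij; rewrite mxE ij. Qed.

(** The weights sum to 1, so 1 minus the boundary weights is the total interior
    weight. *)
Lemma boundary_matrix_dominance i :
  A i i - \sum_(j | j != i) `|A i j|
    = l * k t (bnode i) b + \sum_j weight_int l gamma i b j.
Proof.
rewrite [A i i]mxE eqxx.
under eq_bigr => j ji.
  rewrite offdiag 1?eq_sym// normrN ger0_norm; last exact: weight_bd_ge0.
  over.
have := weight_sum M_mesh (@offset_in i _ Bb).
by rewrite (bigD1 i)//=; lra.
Qed.

Lemma boundary_M_matrix : nonsingular_M_matrix A.
Proof.
apply: dominant_M_matrix => [i j ij|i].
  by rewrite offdiag// oppr_le0 weight_bd_ge0.
rewrite boundary_matrix_dominance ltr_wpDl ?mulr_ge0 ?k_ge0 ?(ltW l_gt0)//.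
exact: lt_le_trans (@theta_le i _ Bb).
Qed.

End Scheme.

(** * The theorem *)

Theorem mainTheorem7 (R : realType) (N NB : nat) (T : R)
    (O : set 'rV[R]_N) (n : 'rV[R]_N -> 'rV[R]_N)
    (B V : set 'rV[R]_NB)
    (g k : R -> 'rV[R]_N -> 'rV[R]_NB -> R)
    (gamma : 'rV[R]_N * 'rV[R]_NB -> 'rV[R]_N)
    (H : set R) (M : R -> mesh R N) (c0 c1 : R) (l : R -> R)
    (* domain and data *)
    (N_gt0 : (0 < N)%N) (T_gt0 : 0 < T)
    (O_nonempty : O !=set0) (O_open : open O) (O_connected : connected O)
    (O_bounded : bounded_set O) (O_C3 : boundary_of_class 3 O)
    (n_normal : forall x, bdry O x -> outward_unit_normal O x (n x))
    (B_nonempty : B !=set0) (B_compact : compact B)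
    (g_cont : {within `[0, T] `*` bdry O `*` B,
                 continuous (fun p => g p.1.1 p.1.2 p.2)})
    (k_cont : {within `[0, T] `*` bdry O `*` B,
                 continuous (fun p => k p.1.1 p.1.2 p.2)})
    (k_ge0 : forall t x b, 0 <= t <= T -> bdry O x -> B b -> 0 <= k t x b)
    (V_open : open V) (B_sub_V : B `<=` V)
    (gamma_C1 : Ck_rel 1 (bdry O `*` V) gamma)
    (gamma_unit : forall x b, bdry O x -> B b -> enorm (gamma (x, b)) = 1)
    (gamma_oblique : forall x b, bdry O x -> B b ->
                       0 < dotp (n x) (gamma (x, b)))
    (* mesh family, h -> 0 *)
    (H_gt0 : forall h, H h -> 0 < h)
    (H_to0 : forall e : R, 0 < e -> exists2 h, H h & h < e)
    (M_mesh : forall h, H h -> mesh_of O h (M h))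
    (M_regular : shape_regular H M)
    (M_interp : interpolation_estimate O H M)
    (* offset *)
    (c0_gt0 : 0 < c0) (c0_le_c1 : c0 <= c1)
    (l_bounds : forall h, H h -> c0 * h <= l h <= c1 * h) :
  exists h0 theta : R, [/\ 0 < h0, 0 < theta < 1 &
    forall h, H h -> h <= h0 ->
    forall NT m : nat, (0 < NT)%N -> (m < NT)%N ->
    let t := time_level T NT m in
    (* (i) *)
    (forall Vint : 'rV[R]_(nint (M h)),
       let Tm := Tn (l h) t gamma g k B Vint in
       let L := Tn_lipschitz_const (M h) (l h) t gamma k B in
       (forall z z' : 'rV[R]_(nbd (M h)),
          `|Tm z - Tm z'| <= L * `|z - z'| <= (1 - theta) * `|z - z'|) /\
       (exists zs : 'rV[R]_(nbd (M h)),
          [/\ zs = Tm zs,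
              forall z, z = Tm z -> z = zs &
              forall z0, (fun q : nat => iter q Tm z0) @ \oo --> zs])) /\
    (* (ii) *)
    (forall b, B = [set b] ->
       let A := boundary_matrix (M h) (l h) t gamma k b in
       (forall i : 'I_(nbd (M h)),
          A i i - \sum_(j | j != i) `|A i j|
            = l h * k t (bnode i) b
              + \sum_j weight_int (l h) gamma i b j
          /\ l h * k t (bnode i) b
              + \sum_j weight_int (l h) gamma i b j >= theta) /\
       nonsingular_M_matrix A)].
Proof.
have [r r0 good] := uniform_interior_weight O_open n_normal B_compact V_open
  B_sub_V gamma_C1 gamma_unit gamma_oblique H_gt0 M_mesh M_interp c0_gt0
  l_bounds O_bounded.
pose theta : R := Num.min r (1 / 2).
have theta0 : 0 < theta by rewrite lt_min r0/= divr_gt0.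
have theta1 : theta < 1 by rewrite gt_min; apply/orP; right; lra.
exists r, theta; split => //; first by rewrite theta0.
move=> h Hh hr NT m NT0 mNT t.
have t_in : 0 <= t <= T.
  have NT0' : (0 : R) < NT%:R by rewrite ltr0n.
  rewrite /t /time_level mulr_ge0 ?divr_ge0 ?ler0n ?(ltW T_gt0)//=.
  by rewrite mulrCA ler_piMr ?(ltW T_gt0)// ler_pdivrMr// mul1r ler_nat ltnW.
have bd (i : 'I_(nbd (M h))) : bdry O (bnode i).
  by case: (M_mesh _ Hh) => _ [_ +] _ _ _; exact.
have l0 : 0 < l h.
  have /andP[l_ge _] := l_bounds _ Hh; apply: lt_le_trans l_ge.
  by rewrite mulr_gt0// H_gt0.
have offset_in (i : 'I_(nbd (M h))) b :
    B b -> closure O (offset_point (l h) gamma i b).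
  by move=> Bb; have [] := good _ (bd i) h Hh hr i b erefl Bb.
have theta_le (i : 'I_(nbd (M h))) b :
    B b -> theta <= \sum_j weight_int (l h) gamma i b j.
  move=> Bb; have [_] := good _ (bd i) h Hh hr i b erefl Bb.
  by apply: le_trans; rewrite ge_min lexx.
have kt_ge0 (i : 'I_(nbd (M h))) b : B b -> 0 <= k t (bnode i) b.
  by move=> Bb; exact: k_ge0.
split=> [Vint Tm L|b BE A].
  have L_le : L <= 1 - theta.
    exact: (Tn_lipschitz_const_le (M_mesh _ Hh) l0 offset_in theta_le kt_ge0
      (ltW theta1)).
  have Tm_lip z z' : `|Tm z - Tm z'| <= L * `|z - z'|.
    exact: (Tn_lipschitz g (M_mesh _ Hh) l0 offset_in theta_le kt_ge0).
  have step (z z' : 'rV[R]_(nbd (M h))) :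
      L * `|z - z'| <= (1 - theta) * `|z - z'| by rewrite ler_wpM2r.
  split=> [z z'|]; first by rewrite Tm_lip step.
  apply: (@contraction_iteration _ _ Tm (1 - theta)).
  - by rewrite subr_ge0 ltW.
  - by rewrite gtrBl.
  - by move=> z z'; exact: le_trans (Tm_lip z z') (step z z').
have Bb : B b by rewrite BE.
split=> [i|].
  split.
    exact: (boundary_matrix_dominance t k (M_mesh _ Hh) offset_in Bb).
  by rewrite (le_trans (theta_le i b Bb))// lerDr mulr_ge0 ?kt_ge0 ?(ltW l0).
exact: (boundary_M_matrix (M_mesh _ Hh) l0 theta0 offset_in theta_le kt_ge0 Bb).
Qed.
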